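(* (The Lattice Isomorphism Theorem) Let $G$ be a gyrogroup and let $N$ be a normal subgyrogroup of $G$. There is a bijection $\Phi$ from the set of subgyrogroups of $G$ containing $N$ onto the set of subgyrogroups of $G/N$ which has the following properties, for all subgyrogroups $A$ and $B$ of $G$ containing $N$: (1) $A\subseteq B$ if and only if $\Phi(A)\subseteq\Phi(B)$; (2) $A$ is an L-subgyrogroup of $G$ if and only if $\Phi(A)$ is an L-subgyrogroup of $G/N$; (3) $A$ is normal in $G$ if and only if $\Phi(A)$ is normal in $G/N$.
   Context: A gyrogroup is a nonempty set $G$ with a binary operation $\oplus$ such that: (G1) there is $0\in G$ with $0\oplus a=a$ for all $a$; (G2) for each $a$ there is $b$ with $b\oplus a=0$; (G3) for all $a,b\in G$ there is an automorphism $\mathrm{gyr}[a,b]$ of $(G,\oplus)$ (a bijection $G\to G$ preserving $\oplus$) with $a\oplus(b\oplus c)=(a\oplus b)\oplus\mathrm{gyr}[a,b]c$ for all $c\in G$; (G4) $\mathrm{gyr}[a,b]=\mathrm{gyr}[a\oplus b,b]$ for all $a,b\in G$. It is known that $0$ is a two-sided identity, every $a$ has a two-sided inverse $\ominus a$, and $\mathrm{gyr}[a,b]c=\ominus(a\oplus b)\oplus(a\oplus(b\oplus c))$. A nonempty subset $H$ of $G$ is a subgyrogroup if $H$ is a gyrogroup under the operation inherited from $G$ and, for all $a,b\in H$, the restriction of $\mathrm{gyr}[a,b]$ to $H$ is an automorphism of $H$. A subgyrogroup $H$ of $G$ is an L-subgyrogroup if $\mathrm{gyr}[a,h](H)=H$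 for all $a\in G$, $h\in H$. A gyrogroup homomorphism is a map between gyrogroups preserving the operations; its kernel is the preimage of $\{0\}$. A subgyrogroup $N$ of $G$ is normal in $G$ if it is the kernel of some gyrogroup homomorphism from $G$ to some gyrogroup. For $N$ normal in $G$, $G/N$ is the quotient gyrogroup: the set of left cosets $a\oplus N=\{a\oplus n:n\in N\}$, $a\in G$, with the well-defined operation $(a\oplus N)\oplus(b\oplus N)=(a\oplus b)\oplus N$. *)

(* Defs.v *)
From HB Require Import structures.
From mathcomp Require Import all_boot all_classical.

Set Implicit Arguments.
Unset Strict Implicit.
Unset Printing Implicit Defensive.

Local Open Scope classical_set_scope.

Declare Scope gyro_scope.
Delimit Scope gyro_scope with gyro.

HB.mixin Record isGyrogroup (T : Type) := {
  gyro0 : T;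
  gyroN : T -> T;
  gyroD : T -> T -> T;
  gyr : T -> T -> T -> T;
  gyro0D : forall a, gyroD gyro0 a = a;
  gyroND : forall a, gyroD (gyroN a) a = gyro0;
  gyr_bij : forall a b, bijective (gyr a b);
  gyr_morph : forall a b x y,
    gyr a b (gyroD x y) = gyroD (gyr a b x) (gyr a b y);
  gyroDA : forall a b c,
    gyroD a (gyroD b c) = gyroD (gyroD a b) (gyr a b c);
  gyr_loop : forall a b, gyr a b = gyr (gyroD a b) b
}.

#[short(type="gyrogroupType")]
HB.structure Definition Gyrogroup := { T of isGyrogroup T }.

Notation "a ⊕ b" := (gyroD a b) (at level 50, left associativity) : gyro_scope.
Notation "⊖ a" := (gyroN a) (at level 35, right associativity) : gyro_scope.

Local Open Scope gyro_scope.

Definition automorphism_on (T : Type) (H : set T) (op : T -> T -> T)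
    (f : T -> T) : Prop :=
  set_bij H H f /\ (forall x y, H x -> H y -> f (op x y) = op (f x) (f y)).

(* The four axioms relativized to a subset H of T; the values of the witness g
   outside H are irrelevant. *)
Definition gyrogroup_on (T : Type) (H : set T) (op : T -> T -> T) : Prop :=
  (forall a b, H a -> H b -> H (op a b)) /\
  (exists e, [/\ H e,
     forall a, H a -> op e a = a &
     forall a, H a -> exists2 b, H b & op b a = e]) /\
  (exists g : T -> T -> T -> T, forall a b, H a -> H b ->
     [/\ automorphism_on H op (g a b),
         forall c, H c -> op a (op b c) = op (op a b) (g a b c) &
         forall c, H c -> g a b c = g (op a b) b c]).

Definition subgyrogroup (G : gyrogroupType) (H : set G) : Prop :=
  [/\ H !=set0, gyrogroup_on H (@gyroD G) &
      forall a b, H a -> H b -> automorphism_on H (@gyroD G) (gyr a b)].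

Definition Lsubgyrogroup (G : gyrogroupType) (H : set G) : Prop :=
  subgyrogroup H /\ forall a h, H h -> gyr a h @` H = H.

Definition gyro_hom (G K : gyrogroupType) (f : G -> K) : Prop :=
  forall a b, f (a ⊕ b) = f a ⊕ f b.

Definition gyro_ker (G K : gyrogroupType) (f : G -> K) : set G :=
  f @^-1` [set gyro0].

Definition normal_subgyrogroup (G : gyrogroupType) (N : set G) : Prop :=
  subgyrogroup N /\
  exists (K : gyrogroupType) (f : G -> K), gyro_hom f /\ N = gyro_ker f.

Definition lcoset (G : gyrogroupType) (N : set G) (a : G) : set G :=
  [set a ⊕ n | n in N].

Section GyrogroupTheory.
Variable G : gyrogroupType.
Implicit Types a b c : G.

Lemma gyroDI a : injective (gyroD a).
Proof.
move=> b c /(congr1 (gyroD (⊖ a))); rewrite !gyroDA gyroND !gyro0D.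
exact/bij_inj/gyr_bij.
Qed.

Lemma gyr0l a b : gyr gyro0 a b = b.
Proof. by apply: (@gyroDI a); rewrite -{1}[a]gyro0D -gyroDA gyro0D. Qed.

Lemma gyroKD a b : ⊖ a ⊕ (a ⊕ b) = b.
Proof. by rewrite gyroDA gyr_loop gyroND gyr0l gyro0D. Qed.

Lemma gyroD0 a : a ⊕ gyro0 = a.
Proof. by apply: (@gyroDI (⊖ a)); rewrite gyroKD gyroND. Qed.

Lemma gyroNK a : ⊖ (⊖ a) = a.
Proof. by rewrite -[LHS]gyroD0 -(gyroND a) gyroKD. Qed.

Lemma gyroKND a b : a ⊕ (⊖ a ⊕ b) = b.
Proof. by rewrite -{1}[a]gyroNK gyroKD. Qed.

Lemma gyroDN a : a ⊕ ⊖ a = gyro0.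
Proof. by rewrite -{1}[a]gyroNK gyroND. Qed.

Lemma gyrE a b c : gyr a b c = ⊖ (a ⊕ b) ⊕ (a ⊕ (b ⊕ c)).
Proof. by rewrite (gyroDA a) gyroKD. Qed.

End GyrogroupTheory.

Section HomTheory.
Variables (G K : gyrogroupType) (f : G -> K).
Hypothesis fD : gyro_hom f.

Lemma gyro_hom0 : f gyro0 = gyro0.
Proof. by apply: (@gyroDI _ (f gyro0)); rewrite -fD !gyroD0. Qed.

Lemma gyro_hom_gyr a b c : f (gyr a b c) = gyr (f a) (f b) (f c).
Proof.
by apply: (@gyroDI _ (f a ⊕ f b)); rewrite -gyroDA -!fD -gyroDA.
Qed.

Lemma gyro_homN a : f (⊖ a) = ⊖ (f a).
Proof.
by apply: (@gyroDI _ (f a)); rewrite -fD !gyroDN gyro_hom0.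
Qed.

Lemma lcoset_kerE a : lcoset (gyro_ker f) a = f @^-1` [set f a].
Proof.
apply/seteqP; split=> [_ [n fn <-]|x /= fx].
  by rewrite /= fD fn gyroD0.
exists (⊖ a ⊕ x); last exact: gyroKND.
by rewrite /gyro_ker /= fD fx -fD gyroND gyro_hom0.
Qed.

End HomTheory.

Section Quotient.
Variables (G : gyrogroupType) (N : set G).

(* Normality is a parameter of the type only so that the gyrogroup structure
   below can be inferred from it. *)
Definition quotient (nN : normal_subgyrogroup N) : Type :=
  {X : set G | exists a, X = lcoset N a}.

Variable nN : normal_subgyrogroup N.
Local Notation Q := (quotient nN).

Definition qcoset (a : G) : Q :=
  exist _ (lcoset N a) (ex_intro _ a erefl).

Definition qrepr (X : Q) : G := projT1 (cid (svalP X)).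

Lemma qreprK X : qcoset (qrepr X) = X.
Proof.
apply: eq_sig_hprop => [? ? ?|]; first exact: Prop_irrelevance.
by rewrite /qrepr /=; case: cid.
Qed.

Lemma qcoset_hom (K : gyrogroupType) (f : G -> K) a b :
  gyro_hom f -> N = gyro_ker f -> (qcoset a = qcoset b) <-> (f a = f b).
Proof.
move=> fD Nf; split=> [/(congr1 sval)/= | fab]; last first.
  by apply: eq_exist; rewrite Nf !lcoset_kerE// fab.
by rewrite Nf !lcoset_kerE// => /seteqP[/(_ a erefl)].
Qed.

(* Defined through chosen representatives; qcosetD, qcosetN and qcoset_gyr show
   that the choice does not matter. *)
Definition quot0 : Q := qcoset gyro0.
Definition quotN (X : Q) : Q := qcoset (⊖ qrepr X).
Definition quotD (X Y : Q) : Q := qcoset (qrepr X ⊕ qrepr Y).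
Definition quot_gyr (X Y Z : Q) : Q :=
  qcoset (gyr (qrepr X) (qrepr Y) (qrepr Z)).

Lemma quotDE a b : quotD (qcoset a) (qcoset b) = qcoset (a ⊕ b).
Proof.
have [_ [K [f [fD Nf]]]] := (nN); apply/(qcoset_hom _ _ fD Nf); rewrite !fD.
by congr (_ ⊕ _); apply/(qcoset_hom _ _ fD Nf); rewrite qreprK.
Qed.

Lemma quotNE a : quotN (qcoset a) = qcoset (⊖ a).
Proof.
have [_ [K [f [fD Nf]]]] := (nN); apply/(qcoset_hom _ _ fD Nf).
rewrite !gyro_homN//.
by congr (⊖ _); apply/(qcoset_hom _ _ fD Nf); rewrite qreprK.
Qed.

Lemma quot_gyrE a b c :
  quot_gyr (qcoset a) (qcoset b) (qcoset c) = qcoset (gyr a b c).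
Proof.
have [_ [K [f [fD Nf]]]] := (nN); apply/(qcoset_hom _ _ fD Nf).
rewrite !gyro_hom_gyr//.
by congr (gyr _ _ _); apply/(qcoset_hom _ _ fD Nf); rewrite qreprK.
Qed.

Let quot0D X : quotD quot0 X = X.
Proof. by rewrite -[X]qreprK quotDE gyro0D. Qed.

Let quotND X : quotD (quotN X) X = quot0.
Proof. by rewrite -[X]qreprK quotNE quotDE gyroND. Qed.

Let quot_gyr_bij X Y : bijective (quot_gyr X Y).
Proof.
rewrite -setTT_bijective -[X]qreprK -[Y]qreprK; split=> //.
- move=> Z W _ _; rewrite -[Z]qreprK -[W]qreprK !quot_gyrE.
  have [_ [K [f [fD Nf]]]] := (nN); move=> /(qcoset_hom _ _ fD Nf).
  rewrite !gyro_hom_gyr// => /(bij_inj (gyr_bij _ _)) ?.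
  exact/(qcoset_hom _ _ fD Nf).
- move=> Z _; have [g _ gK] := gyr_bij (qrepr X) (qrepr Y).
  by exists (qcoset (g (qrepr Z))); rewrite // quot_gyrE gK qreprK.
Qed.

Let quot_gyr_morph X Y Z W :
  quot_gyr X Y (quotD Z W) = quotD (quot_gyr X Y Z) (quot_gyr X Y W).
Proof.
rewrite -[X]qreprK -[Y]qreprK -[Z]qreprK -[W]qreprK.
by rewrite !(quotDE, quot_gyrE) gyr_morph.
Qed.

Let quotDA X Y Z :
  quotD X (quotD Y Z) = quotD (quotD X Y) (quot_gyr X Y Z).
Proof.
rewrite -[X]qreprK -[Y]qreprK -[Z]qreprK.
by rewrite !(quotDE, quot_gyrE) gyroDA.
Qed.

Let quot_gyr_loop X Y : quot_gyr X Y = quot_gyr (quotD X Y) Y.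
Proof.
apply/funext => Z; rewrite -[X]qreprK -[Y]qreprK -[Z]qreprK.
by rewrite !(quotDE, quot_gyrE) -gyr_loop.
Qed.

HB.instance Definition _ := isGyrogroup.Build Q quot0D quotND
  quot_gyr_bij quot_gyr_morph quotDA quot_gyr_loop.

Lemma qcosetD a b : qcoset a ⊕ qcoset b = qcoset (a ⊕ b) :> Q.
Proof. exact: quotDE. Qed.

Lemma qcosetN a : ⊖ qcoset a = qcoset (⊖ a) :> Q.
Proof. exact: quotNE. Qed.

Lemma qcoset_gyr a b c :
  gyr (qcoset a) (qcoset b) (qcoset c) = qcoset (gyr a b c) :> Q.
Proof. exact: quot_gyrE. Qed.

End Quotient.

(* Main.v *)
Require Import Defs.
From mathcomp Require Import all_boot all_classical.
Local Open Scope classical_set_scope.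

(** The correspondence is direct image A |-> f @` A along the projection
    f : G -> G/N, with inverse the preimage. Everything rests on one fact: if a
    subgyrogroup A contains the kernel of f, then A is saturated, that is,
    membership of x in A can be read off f x ([mem_image_ker]). Indeed, if
    f x = f a with a in A, then x = a ⊕ n with n in the kernel.

    The properties to be transported are then put in a form that only speaks of
    membership. A subgyrogroup is a subset containing 0 and closed under ⊕ and ⊖
    ([subgyrogroupP]); such a set is an L-subgyrogroup when membership is
    invariant under each gyr a h with h in the set ([LsubgyrogroupP]). As f
    commutes with 0, ⊕, ⊖ and gyr, these conditions hold upstairs exactly when
    they hold downstairs.

    Normality is not a condition on membership. A homomorphism on G/N with kernel
    f @` A yields one on G with kernel A by composition with f; conversely, a
    homomorphism on G with kernel A kills N and therefore factors through f
    ([gyro_hom_factor]).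

    The argument holds for every surjective homomorphism f with N = gyro_ker f,
    and the lemmas are stated at that generality. *)

Set Implicit Arguments.
Unset Strict Implicit.
Unset Printing Implicit Defensive.

Local Open Scope gyro_scope.

Section Subgyrogroups.
Variables (G : gyrogroupType) (H : set G).

(** Since gyr a b c = ⊖ (a ⊕ b) ⊕ (a ⊕ (b ⊕ c)) and this formula can be solved
    for c by ⊕ and ⊖ alone, closure under ⊕ and ⊖ already forces every gyr a b
    with a, b in H to restrict to a permutation of H. *)
Lemma subgyrogroupP :
  subgyrogroup H <->
  [/\ H gyro0, forall a b, H a -> H b -> H (a ⊕ b) &
      forall a, H a -> H (⊖ a)].
Proof.
split=> [[_ [HD [[e [He e0D eN]] _]] _]|[H0 HD HN]].
  (* an idempotent e is 0, by cancellation in e ⊕ e = e ⊕ 0 *)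
  have e0 : e = gyro0 by apply: (@gyroDI _ e); rewrite e0D// gyroD0.
  rewrite {}e0 in He e0D eN; split=> // a /eN[b Hb ba0].
  suff -> : a = ⊖ b by rewrite gyroNK.
  by apply: (@gyroDI _ b); rewrite ba0 gyroDN.
have Hgyr a b : H a -> H b -> automorphism_on H (@gyroD G) (gyr a b).
  move=> Ha Hb; split; last by move=> *; exact: gyr_morph.
  split=> [c Hc|c d _ _ /(bij_inj (gyr_bij a b))//|c Hc].
    by rewrite gyrE; apply: (HD); [exact/HN/HD|do 2 apply: (HD) => //].
  exists (⊖ b ⊕ (⊖ a ⊕ ((a ⊕ b) ⊕ c))).
    by do 2 (apply: (HD); first exact: HN); apply: (HD) => //; exact: HD.
  by rewrite gyrE !gyroKND gyroKD.
split=> //; first by exists gyro0.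
split=> //; split.
  exists gyro0; split=> // a Ha; first exact: gyro0D.
  by exists (⊖ a); [exact: HN|exact: gyroND].
exists (@gyr G) => a b Ha Hb; split; first exact: Hgyr.
  by move=> c _; exact: gyroDA.
by move=> c _; rewrite -gyr_loop.
Qed.

(** As gyr a h is a bijection of the whole of G, it maps H onto H exactly when
    both it and its inverse preserve membership in H. *)
Lemma LsubgyrogroupP :
  Lsubgyrogroup H <->
  subgyrogroup H /\ forall a h x, H h -> H (gyr a h x) <-> H x.
Proof.
split=> -[sH HL]; split=> //; [move=> a h x /(HL a) E|move=> a h Hh].
  split=> [|Hx]; last by rewrite -E; exists x.
  by rewrite -{1}E => -[y Hy /(bij_inj (gyr_bij a h)) <-].
apply/seteqP; split=> [_ [x Hx <-]|x Hx]; first exact/HL.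
have [g _ gK] := gyr_bij a h.
by exists (g x); rewrite ?gK//; apply/(HL a h _ Hh); rewrite gK.
Qed.

End Subgyrogroups.

Section SurjectiveHom.
Variables (G K : gyrogroupType) (f : G -> K).
Hypotheses (fD : gyro_hom f) (f_surj : forall y, exists x, f x = y).

Lemma subgyrogroup_image (A : set G) :
  subgyrogroup A -> subgyrogroup (f @` A).
Proof.
move=> /subgyrogroupP[A0 AD AN]; apply/subgyrogroupP; split.
- by exists gyro0 => //; exact: gyro_hom0.
- by move=> _ _ [a Aa <-] [b Ab <-]; exists (a ⊕ b); [exact: AD|exact: fD].
- by move=> _ [a Aa <-]; exists (⊖ a); [exact: AN|exact: gyro_homN].
Qed.

Lemma subgyrogroup_preimage (B : set K) :
  subgyrogroup B -> subgyrogroup (f @^-1` B).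
Proof.
move=> /subgyrogroupP[B0 BD BN]; apply/subgyrogroupP; split=> /=.
- by rewrite gyro_hom0.
- by move=> a b Ba Bb; rewrite fD; exact: BD.
- by move=> a Ba; rewrite gyro_homN//; exact: BN.
Qed.

Lemma gyro_ker_preimage (B : set K) :
  subgyrogroup B -> gyro_ker f `<=` f @^-1` B.
Proof. by move=> /subgyrogroupP[B0 _ _] x /= ->. Qed.

(** The fibre of f through a is the left coset of the kernel through a, and that
    coset stays inside A when a does. *)
Lemma mem_image_ker (A : set G) x :
  subgyrogroup A -> gyro_ker f `<=` A -> (f @` A) (f x) <-> A x.
Proof.
move=> /subgyrogroupP[_ AD _] kA; split=> [[a Aa fax]|Ax]; last by exists x.
have : lcoset (gyro_ker f) a x by rewrite lcoset_kerE//=.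
by move=> [n /kA An <-]; exact: AD.
Qed.

Lemma image_sub_ker (A B : set G) :
  subgyrogroup B -> gyro_ker f `<=` B -> A `<=` B <-> f @` A `<=` f @` B.
Proof.
move=> sB kB; split=> [|AB x Ax]; first exact: image_subset.
by apply/(mem_image_ker _ sB kB)/AB; exists x.
Qed.

Lemma image_subgyrogroup_bij :
  set_bij [set A : set G | subgyrogroup A /\ gyro_ker f `<=` A]
          [set B : set K | subgyrogroup B] (fun A => f @` A).
Proof.
split=> [A [sA _]|A B /set_mem[sA kA] /set_mem[sB kB] E|B sB].
- exact: subgyrogroup_image.
- by apply/seteqP; split; apply/image_sub_ker; rewrite ?E.
exists (f @^-1` B); last by apply: image_preimage; apply/seteqP; split=> // y _;
  have [x <-] := f_surj y; exists x.
by split; [exact: subgyrogroup_preimage|exact: gyro_ker_preimage].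
Qed.

Lemma Lsubgyrogroup_image (A : set G) :
  subgyrogroup A -> gyro_ker f `<=` A ->
  Lsubgyrogroup A <-> Lsubgyrogroup (f @` A).
Proof.
move=> sA kA; have fA x := mem_image_ker x sA kA.
split=> /LsubgyrogroupP[_ AL]; apply/LsubgyrogroupP; split=> //.
- exact: subgyrogroup_image.
- move=> a' h' x'; have [[a <-] [h <-]] := (f_surj a', f_surj h').
  have [x <-] := f_surj x'; rewrite -gyro_hom_gyr// !fA; exact: AL.
- by move=> a h x /fA Ah; rewrite -!fA gyro_hom_gyr//; exact: AL.
Qed.

(** Elements with the same image under f differ by an element of the kernel of
    f, hence of g, so g x depends on f x only. *)
Lemma gyro_hom_factor (L : gyrogroupType) (g : G -> L) :
  gyro_hom g -> gyro_ker f `<=` gyro_ker g ->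
  exists2 g' : K -> L, gyro_hom g' & forall x, g' (f x) = g x.
Proof.
move=> gD kfg; have [s sK] := choice f_surj.
have gs x : g (s (f x)) = g x.
  have : lcoset (gyro_ker f) x (s (f x)) by rewrite lcoset_kerE//=.
  by move=> [n /kfg gn <-]; rewrite gD gn gyroD0.
exists (g \o s) => //= y z /=.
by rewrite -[y in LHS]sK -[z in LHS]sK -fD gs gD.
Qed.

Lemma normal_subgyrogroup_image (A : set G) :
  subgyrogroup A -> gyro_ker f `<=` A ->
  normal_subgyrogroup A <-> normal_subgyrogroup (f @` A).
Proof.
move=> sA kA; have fA x := mem_image_ker x sA kA.
split=> -[_ [L [g [gD Ag]]]].
  split; first exact: subgyrogroup_image.
  have [g' g'D g'f] : exists2 g' : K -> L, gyro_hom g' &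
      forall x, g' (f x) = g x by apply: gyro_hom_factor; rewrite -?Ag.
  exists L, g'; split=> //; apply/seteqP.
  by split=> y; have [x <-] := f_surj y;
    rewrite fA Ag /gyro_ker /= g'f.
split=> //; exists L, (g \o f); split=> [a b /=|]; first by rewrite fD gD.
by apply/seteqP; split=> x; rewrite -fA Ag.
Qed.

End SurjectiveHom.

Section Projection.
Variables (G : gyrogroupType) (N : set G) (nN : normal_subgyrogroup N).

Lemma qcoset_gyro_hom : gyro_hom (qcoset nN).
Proof. by move=> a b; rewrite qcosetD. Qed.

Lemma qcoset_surj (X : quotient nN) : exists a, qcoset nN a = X.
Proof. by exists (qrepr X); exact: qreprK. Qed.

Lemma gyro_ker_qcoset : gyro_ker (qcoset nN) = N.
Proof.
have [_ [K [f [fD Nf]]]] := (nN).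
have qE x : gyro_ker (qcoset nN) x <-> f x = f gyro0.
  exact: (qcoset_hom nN x gyro0 fD Nf).
by rewrite [RHS]Nf; apply/seteqP; split=> x; rewrite qE gyro_hom0.
Qed.

End Projection.

Theorem theorem5p10 (G : gyrogroupType) (N : set G)
    (nN : normal_subgyrogroup N) :
  exists Phi : set G -> set (quotient nN),
    set_bij [set A : set G | subgyrogroup A /\ N `<=` A]
            [set B : set (quotient nN) | subgyrogroup B] Phi /\
    forall A B : set G,
      subgyrogroup A -> N `<=` A -> subgyrogroup B -> N `<=` B ->
      [/\ A `<=` B <-> Phi A `<=` Phi B,
          Lsubgyrogroup A <-> Lsubgyrogroup (Phi A) &
          normal_subgyrogroup A <-> normal_subgyrogroup (Phi A)].
Proof.
have qD := qcoset_gyro_hom nN; have q_surj := @qcoset_surj _ _ nN.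
have kq := gyro_ker_qcoset nN.
exists (fun A => qcoset nN @` A); split.
  by have := image_subgyrogroup_bij qD q_surj; rewrite kq.
move=> A B sA NA sB NB; split.
- by apply: image_sub_ker; rewrite ?kq.
- by apply: Lsubgyrogroup_image; rewrite ?kq.
- by apply: normal_subgyrogroup_image; rewrite ?kq.
Qed.
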